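(* For any map $\iota_X\colon A\to X$ and any integer $k\ge 0$, $$\operatorname{relcat} g_k(\iota_X)=\left\lfloor \frac{\operatorname{relcat}_k\iota_X}{k+1}\right\rfloor ,$$ where $g_k(\iota_X)\colon G_k(\iota_X)\to X$ is the $k$-th Ganea map of $\iota_X$.
   Context: Spaces are topological spaces; $\simeq$ denotes homotopy of maps, and all squares below commute up to homotopy. $\lfloor q\rfloor$ is the integer part of $q$. Ganea construction. For a map $\iota_X\colon A\to X$, define maps $g_i=g_i(\iota_X)\colon G_i=G_i(\iota_X)\to X$ for $i\ge 0$ inductively. Start with $G_0=A$, $g_0=\iota_X$ and $\alpha_0=\mathrm{id}_A$. Given $g_i$, let $F_i$ be the homotopy pullback of $g_i\colon G_i\to X$ and $\iota_X\colon A\to X$, with projections $\beta_i\colon F_i\to G_i$ and $\eta_i\colon F_i\to A$. Let $G_{i+1}$ be the homotopy pushout of $\beta_i$ and $\eta_i$, with structure maps $\gamma_i\colon G_i\to G_{i+1}$ and $\alpha_{i+1}\colon A\to G_{i+1}$. Let $g_{i+1}\colon G_{i+1}\to X$ be the map induced by $g_i$, $\iota_X$ and the homotopy of the pullback square, so that $g_{i+1}\circ\gamma_i\simeq g_i$ and $g_{i+1}\circ\alpha_{i+1}\simeq\iota_X$. That is, $g_{i+1}$ is the join of $g_i$ and $\iota_X$ over $X$. For $0\le k< i$ let $\gamma_{k,i}\simeq \gamma_{i-1}\circ\cdots\circ\gamma_{k+1}\circ\gamma_k\colon G_k\to G_i$, and $\gamma_{k,k}=\mathrm{id}_{G_k}$.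 (Equivalently, by associativity of the join, $G_i$ is the homotopy pushout of the two projections from the homotopy pullback of $g_k$ and $g_{i-k-1}$, and $\gamma_{k,i}$ is the structure map from $G_k$.) Relative category. For any map $f\colon B\to X$, $\operatorname{relcat} f$ is the least integer $n\ge 0$ such that $g_n(f)\colon G_n(f)\to X$ has a homotopy section $\sigma\colon X\to G_n(f)$ (i.e. $g_n(f)\circ\sigma\simeq\mathrm{id}_X$) with $\sigma\circ f\simeq\alpha_n$, where $\alpha_n\colon B\to G_n(f)$ is the map of the Ganea construction of $f$. In the claim, $\operatorname{relcat} g_k(\iota_X)$ is this invariant for $f=g_k(\iota_X)$. Relative category of order $k$. $\operatorname{relcat}_k\iota_X$ is the least integer $n\ge k$ such that $g_n\colon G_n(\iota_X)\to X$ has a homotopy section $\sigma$ with $\sigma\circ g_k\simeq\gamma_{k,n}$. If no such integer exists, the corresponding invariant is $\infty$, and $\lfloor\infty/(k+1)\rfloor=\infty$. *)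

(* Defs.v *)
From HB Require Import structures.
From Stdlib Require Import Relation_Operators.
From mathcomp Require Import all_boot all_order all_algebra generic_quotient.
From mathcomp Require Import all_classical all_reals all_analysis.
Set Implicit Arguments.
Unset Strict Implicit.
Unset Printing Implicit Defensive.
Import Order.TTheory GRing.Theory Num.Theory.
Import numFieldNormedType.Exports.
Local Open Scope classical_set_scope.
Local Open Scope ring_scope.
Local Open Scope quotient_scope.

(* A [topologicalType] may be empty and satisfies no separation axiom.  Maps
   are plain functions together with continuity hypotheses. *)

Section interval.
Variable R : realType.

Definition I01 : topologicalType := set_type (`[0, 1]%classic : set R).

Fact I01_zero_subproof : (0 : R) \in (`[0, 1]%classic : set R).
Proof. by rewrite inE /= in_itv /= lexx ler01. Qed.

Fact I01_one_subproof : (1 : R) \in (`[0, 1]%classic : set R).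
Proof. by rewrite inE /= in_itv /= lexx ler01. Qed.

Definition i0 : I01 := SigSub I01_zero_subproof.
Definition i1 : I01 := SigSub I01_one_subproof.

Definition homotopic (S T : topologicalType) (f g : S -> T) : Prop :=
  exists H : S * I01 -> T,
    [/\ continuous H, forall s, H (s, i0) = f s & forall s, H (s, i1) = g s].

End interval.

Lemma I01_compact (R : realType) : compact [set: I01 R].
Proof.
move=> F FF _.
have [p [pI clp]] := @segment_compact R 0 1 (set_val @ F) _
   (@filterS _ F _ setT _ (fun x _ => set_valP x) filterT).
have pI' : p \in (`[0, 1]%classic : set R) by exact/mem_set.
exists (exist _ p pI'); split=> // U V FU [W [[W' oW' <-] /= W'p WV]].
have [||y [[x Ux <-] W'y]] := clp (set_val @` U) W'.
- by apply: (@filterS _ F _ U) FU => x Ux; exists x.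
- exact: open_nbhs_nbhs.
by exists x; split=> //; exact: WV.
Qed.

Lemma I01_hausdorff (R : realType) : hausdorff_space (I01 R).
Proof.
move=> x y cl; apply: val_inj.
apply: (@Rhausdorff R) => U V Ux Vy.
have [|| z [Uz Vz]] := cl (set_val @^-1` U) (set_val @^-1` V).
- exact: (@initial_continuous _ _ (set_val : I01 R -> R) x).
- exact: (@initial_continuous _ _ (set_val : I01 R -> R) y).
by exists (set_val z).
Qed.

Section homotopy_pullback.
Variables (R : realType) (B A X : topologicalType) (p : B -> X) (q : A -> X).

(* The standard model: triples (b, w, a) with w a path from p b to q a, as a
   subspace of B * X^I * A, where X^I carries the compact-open topology. *)
Definition hpullback : topologicalType :=
  set_type [set z : B * {compact-open, I01 R -> X} * A |
    [/\ continuous (z.1.2 : I01 R -> X),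
        z.1.2 (i0 R) = p z.1.1 & z.1.2 (i1 R) = q z.2]].

Definition hpb_fst (z : hpullback) : B := (set_val z).1.1.
Definition hpb_snd (z : hpullback) : A := (set_val z).2.
Definition hpb_htpy (zt : hpullback * I01 R) : X := (set_val zt.1).1.2 zt.2.

End homotopy_pullback.

Arguments hpb_fst R {B A X} p q z.
Arguments hpb_snd R {B A X} p q z.
Arguments hpb_htpy R {B A X} p q zt.

Lemma hpb_htpy_continuous (R : realType) (B A X : topologicalType)
    (p : B -> X) (q : A -> X) :
  continuous (hpb_htpy R p q).
Proof.
pose f (z : hpullback R p q) : {compact-open, I01 R -> X} := (set_val z).1.2.
have -> : hpb_htpy R p q = uncurry (f : _ -> I01 R -> X).
  by apply/funext => -[z t].
apply: continuous_uncurry.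
- move=> x _; exists setT; first exact: filterT.
  by split; [exact: I01_compact|exact: closedT].
- exact: I01_hausdorff.
- pose P := (B * {compact-open, I01 R -> X} * A)%type.
  have cv : continuous (set_val : hpullback R p q -> P) by exact: initial_continuous.
  have c1 : continuous (fst : P -> _) by move=> ?; exact: cvg_fst.
  have c2 : continuous (snd : B * {compact-open, I01 R -> X} -> _) by move=> ?; exact: cvg_snd.
  move=> z; have h := continuous_comp (cv z) (c1 _).
  exact: (continuous_comp h (c2 _)).
- by move=> z; case: (set_valP z).
Qed.

Section homotopy_pushout.
Variables (R : realType) (F B A : topologicalType).
Variables (beta : F -> B) (eta : F -> A).

(* The standard model: the double mapping cylinder, i.e. the quotient of the
   disjoint sum of B, F * [0, 1] and A by (x, 0) ~ beta x and (x, 1) ~ eta x. *)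
Definition cyl_piece (i : option bool) : topologicalType :=
  match i with
  | Some true => B
  | None => (F * I01 R)%type
  | Some false => A
  end.

Definition cyl_sum : topologicalType := {i : option bool & cyl_piece i}.

Definition cyl_inl (b : B) : cyl_sum := existT cyl_piece (Some true) b.
Definition cyl_mid (xt : F * I01 R) : cyl_sum := existT cyl_piece None xt.
Definition cyl_inr (a : A) : cyl_sum := existT cyl_piece (Some false) a.

Inductive cyl_glue : cyl_sum -> cyl_sum -> Prop :=
| CylGlue0 x : cyl_glue (cyl_mid (x, i0 R)) (cyl_inl (beta x))
| CylGlue1 x : cyl_glue (cyl_mid (x, i1 R)) (cyl_inr (eta x)).

Let cyl_rel' (u v : cyl_sum) : bool := `[< clos_refl_sym_trans _ cyl_glue u v >].

Local Lemma cyl_rel_refl : reflexive cyl_rel'.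
Proof. by move=> u; apply/asboolP; exact: rst_refl. Qed.

Local Lemma cyl_rel_sym : symmetric cyl_rel'.
Proof.
by move=> u v; apply/asboolP/asboolP => uv; exact: rst_sym.
Qed.

Local Lemma cyl_rel_trans : transitive cyl_rel'.
Proof.
by move=> v u w /asboolP uv /asboolP vw; apply/asboolP; exact: rst_trans uv vw.
Qed.

Definition cyl_rel := EquivRel _ cyl_rel_refl cyl_rel_sym cyl_rel_trans.

Definition hpushout : topologicalType := quotient_topology {eq_quot cyl_rel}.

Definition hpo_pi (u : cyl_sum) : hpushout := \pi_{eq_quot cyl_rel} u.
Definition hpo_inl (b : B) : hpushout := hpo_pi (cyl_inl b).
Definition hpo_inr (a : A) : hpushout := hpo_pi (cyl_inr a).

Section induced_map.
Variables (X : topologicalType) (u : B -> X) (v : A -> X) (H : F * I01 R -> X).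

Definition cyl_sum_map (s : cyl_sum) : X :=
  match s with
  | existT i y =>
    match i return cyl_piece i -> X with
    | Some true => u
    | None => H
    | Some false => v
    end y
  end.

(* Independent of the choice of representatives when H is a homotopy from
   u \o beta to v \o eta, see [hpo_mapE]. *)
Definition hpo_map (z : hpushout) : X :=
  cyl_sum_map (repr (z : {eq_quot cyl_rel})).

Hypothesis H0 : forall x, H (x, i0 R) = u (beta x).
Hypothesis H1 : forall x, H (x, i1 R) = v (eta x).

Lemma hpo_mapE s : hpo_map (hpo_pi s) = cyl_sum_map s.
Proof.
have rstE a b : clos_refl_sym_trans _ cyl_glue a b ->
    cyl_sum_map a = cyl_sum_map b.
  by elim=> {a b} // [a b [] x /=|a b c _ -> _ ->//]; [exact: H0|exact: H1].
apply: rstE; apply/asboolP; rewrite -/(cyl_rel' _ _).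
have /eqmodP := reprK (hpo_pi s : {eq_quot cyl_rel}).
exact.
Qed.

Lemma hpo_map_continuous :
  continuous u -> continuous v -> continuous H -> continuous hpo_map.
Proof.
move=> cu cv cH; apply/(@quotient_continuous _ {eq_quot cyl_rel}).
have -> : hpo_map \o \pi_{eq_quot cyl_rel} = cyl_sum_map.
  by apply/funext => s; exact: hpo_mapE.
by move=> [i y]; case: i y => [[]|] y W Wy; [exact: cu|exact: cv|exact: cH].
Qed.

End induced_map.
End homotopy_pushout.

Arguments hpo_inl R {F B A} beta eta b.
Arguments hpo_inr R {F B A} beta eta a.
Arguments hpo_map R {F B A} beta eta {X} u v H z.

Section ganea.
Variables (R : realType) (A X : topologicalType) (iota : A -> X).

Record ganea_stage := GaneaStage {
  gs_space : topologicalType;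
  gs_map : gs_space -> X;
  gs_alpha : A -> gs_space
}.

Definition ganea_next (s : ganea_stage) : ganea_stage :=
  let beta := hpb_fst R (gs_map (g := s)) iota in
  let eta := hpb_snd R (gs_map (g := s)) iota in
  @GaneaStage (hpushout R beta eta)
    (hpo_map R beta eta (gs_map (g := s)) iota
      (hpb_htpy R (gs_map (g := s)) iota))
    (hpo_inr R beta eta).

Fixpoint ganea (i : nat) : ganea_stage :=
  match i with
  | 0%N => @GaneaStage A iota id
  | i'.+1 => ganea_next (ganea i')
  end.

Definition ganea_space (i : nat) : topologicalType := gs_space (ganea i).
Definition ganea_map (i : nat) : ganea_space i -> X := @gs_map (ganea i).
Definition ganea_alpha (i : nat) : A -> ganea_space i := @gs_alpha (ganea i).

Definition ganea_gamma (i : nat) : ganea_space i -> ganea_space i.+1 :=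
  hpo_inl R (hpb_fst R (@ganea_map i) iota) (hpb_snd R (@ganea_map i) iota).

(* gamma_{k, m + k}, the composite of gamma_k, ..., gamma_{m + k - 1}; the
   target is indexed by the difference m so that no transport is needed. *)
Fixpoint ganea_gammas (k m : nat) : ganea_space k -> ganea_space (m + k) :=
  match m return ganea_space k -> ganea_space (m + k) with
  | 0%N => id
  | m'.+1 => @ganea_gamma (m' + k) \o @ganea_gammas k m'
  end.

End ganea.

Arguments ganea_map R {A X} iota i x : rename.
Arguments ganea_alpha R {A X} iota i a : rename.
Arguments ganea_gamma R {A X} iota i x : rename.
Arguments ganea_gammas R {A X} iota k m x : rename.

Lemma ganea_map_continuous (R : realType) (A X : topologicalType)
    (iota : A -> X) i :
  continuous iota -> continuous (ganea_map R iota i).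
Proof.
move=> ci; elim: i => [//|i IH].
apply: hpo_map_continuous => //.
- by move=> x; rewrite /hpb_htpy /=; have [_ ? _] := set_valP x.
- by move=> x; rewrite /hpb_htpy /=; have [_ _ ?] := set_valP x.
- exact: hpb_htpy_continuous.
Qed.

(* [None] stands for infinity. *)
Definition least (P : nat -> Prop) : option nat :=
  match pselect (exists n, `[< P n >]) with
  | left exP => Some (ex_minn exP)
  | right _ => None
  end.

Section relcat.
Variable R : realType.

Definition relcat (B X : topologicalType) (f : B -> X) : option nat :=
  least (fun n => exists sigma : X -> ganea_space R f n,
    [/\ continuous sigma,
        homotopic R (ganea_map R f n \o sigma) id &
        homotopic R (sigma \o f) (ganea_alpha R f n)]).

(* The condition n >= k is expressed by n = m + k. *)
Definition relcat_order (k : nat) (A X : topologicalType) (iota : A -> X) :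
    option nat :=
  least (fun n => exists2 m, n = (m + k)%N &
    exists sigma : X -> ganea_space R iota (m + k),
    [/\ continuous sigma,
        homotopic R (ganea_map R iota (m + k) \o sigma) id &
        homotopic R (sigma \o ganea_map R iota k) (ganea_gammas R iota k m)]).

End relcat.

(* Main.v *)
Require Import Defs.
From mathcomp Require Import all_boot all_order all_algebra generic_quotient.
From mathcomp Require Import all_classical all_reals all_analysis.
From mathcomp Require Import ring lra.
Set Implicit Arguments.
Unset Strict Implicit.
Unset Printing Implicit Defensive.
Import Order.TTheory GRing.Theory Num.Theory.
Import numFieldNormedType.Exports.
Local Open Scope classical_set_scope.
Local Open Scope ring_scope.
Local Open Scope quotient_scope.

(* Both inequalities only need maps over X and under G_k (up to homotopy)
   between G_n(g_k) and G_{n(k+1)+k}(iota), in both directions; these maps need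
   not be inverse equivalences.  They come by induction from maps in both
   directions between E * (F * A) and (E * F) * A, where * is the join over X.
   A map phi : Z -> X lifts up to homotopy to the join of p : E -> X and
   q : F -> X as soon as Z is covered by two sets {t < 1} and {t > 0}, t real
   valued and continuous, over which phi lifts up to homotopy to E and to F:
   where both lifts exist, the two homotopies provide the path required in the
   homotopy pullback.  Conversely a join carries such a cover, so associativity
   of the join reduces to regrouping a cover by three sets. *)

(** * Pointwise continuity *)

Lemma continuous_at_comp (S T U : topologicalType) (f : S -> T) (g : T -> U) x :
  continuous_at x f -> continuous_at (f x) g ->
  continuous_at x (fun y => g (f y)).
Proof. by move=> cf cg; apply: (cvg_comp _ _ cf cg). Qed.

Lemma continuous_o (S T U : topologicalType) (f : S -> T) (g : T -> U) :
  continuous f -> continuous g -> continuous (g \o f).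
Proof. by move=> cf cg x; exact: continuous_at_comp (cf x) (cg _). Qed.

Lemma continuous_at_cst (S T : topologicalType) (x : S) (y : T) :
  continuous_at x (fun=> y).
Proof. exact: cvg_cst. Qed.

Lemma continuous_at_pair (S T U : topologicalType) (f : S -> T) (g : S -> U) x :
  continuous_at x f -> continuous_at x g ->
  continuous_at x (fun y => (f y, g y)).
Proof. by move=> cf cg; apply: cvg_pair. Qed.

Lemma continuous_at_fst (S T : topologicalType) (x : S * T) :
  continuous_at x fst.
Proof. exact: cvg_fst. Qed.

Lemma continuous_at_snd (S T : topologicalType) (x : S * T) :
  continuous_at x snd.
Proof. exact: cvg_snd. Qed.

Lemma continuous_at_near (S T : topologicalType) (f g : S -> T) x :
  (\forall y \near x, f y = g y) -> continuous_at x f -> continuous_at x g.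
Proof.
move=> fg cf; rewrite /continuous_at -(nbhs_singleton fg).
by apply: cvg_trans cf; apply: near_eq_cvg; apply: filterS fg => y ->.
Qed.

(** Pasting along the zero set of [c]: each branch is tested only on its own closed side, so
    branches with junk values elsewhere can be glued. *)
Lemma continuous_at_if (R : realType) (S T : topologicalType) (c : S -> R)
    (f g : S -> T) x :
  continuous_at x c ->
  (c x <= 0 -> continuous_at x f) -> (0 <= c x -> continuous_at x g) ->
  (c x = 0 -> f x = g x) ->
  continuous_at x (fun y => if c y <= 0 then f y else g y).
Proof.
move=> cc cf cg fg; case: (ltgtP (c x) 0) => [cx|cx|cx].
- apply: (@continuous_at_near _ _ f); last by apply: cf; exact: ltW.
  by apply: filterS (cvgr_lt _ cc _ cx) => y /= cy; rewrite ltW.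
- apply: (@continuous_at_near _ _ g); last by apply: cg; exact: ltW.
  by apply: filterS (cvgr_gt _ cc _ cx) => y /= cy; rewrite leNgt cy.
- rewrite /continuous_at cx lexx => W Wx.
  have Wf : nbhs x (f @^-1` W) by apply: cf => //; rewrite cx.
  have Wg : nbhs x (g @^-1` W) by apply: cg; rewrite ?cx// -fg.
  by apply: filterS2 Wf Wg => y /= ? ?; case: ifP.
Qed.

(** A tube argument over each compact subset of [K]. Continuity of [W] is asked only above [x],
    which suits paths that are meaningful over part of [S]. *)
Lemma continuous_at_curry (S K T : topologicalType) (W : S * K -> T) x :
  (forall k, continuous_at (x, k) W) ->
  continuous_at x (fun y => (fun k => W (y, k)) : {compact-open, K -> T}).
Proof.
move=> cW; apply/compact_open_cvgP => C O /= cptC oO WCO.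
near=> z => w /= [+ + <-]; near: z.
move/compact_near_coveringP/near_covering_withinP : cptC; apply.
move=> v Cv; have [[P Q] [Px Qv] PQfO] : nbhs (x, v) (W @^-1` O).
  by apply: cW; move: oO; rewrite openE; apply; apply: WCO; exists v.
by exists (Q, P) => // -[b a] /= [Qb Pa] Kb; exact: PQfO.
Unshelve. all: by end_near. Qed.

(** * The unit interval *)

Section unit_interval.
Variable R : realType.
Implicit Types (x : R) (s : I01 R).

Lemma val_i0 : set_val (i0 R) = 0. Proof. by []. Qed.

Lemma val_i1 : set_val (i1 R) = 1. Proof. by []. Qed.

Lemma I01_ge0 s : 0 <= set_val s.
Proof. by have := set_valP s; rewrite /= in_itv /= => /andP[]. Qed.

Lemma I01_le1 s : set_val s <= 1.
Proof. by have := set_valP s; rewrite /= in_itv /= => /andP[]. Qed.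

Fact clamp_subproof x : Num.max 0 (Num.min 1 x) \in (`[0, 1]%classic : set R).
Proof.
by rewrite inE /= in_itv /= le_max lexx /= ge_max ler01 ge_min lexx.
Qed.

(** The retraction of the line onto the interval: reparametrisations become plain real formulas that
    carry no membership proofs. *)
Definition clamp x : I01 R := SigSub (clamp_subproof x).

Lemma val_clamp x : set_val (clamp x) = Num.max 0 (Num.min 1 x).
Proof. by []. Qed.

Lemma clampE x : 0 <= x <= 1 -> set_val (clamp x) = x.
Proof. by case/andP=> x0 x1; rewrite val_clamp min_r// max_r. Qed.

Lemma clamp_val s : clamp (set_val s) = s.
Proof. by apply: val_inj; apply: clampE; rewrite I01_ge0 I01_le1. Qed.

Lemma clamp_le0 x : x <= 0 -> clamp x = i0 R.
Proof.
move=> x0; apply: val_inj; rewrite [LHS]val_clamp.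
by rewrite min_r ?max_l// (le_trans x0).
Qed.

Lemma clamp_ge1 x : 1 <= x -> clamp x = i1 R.
Proof. by move=> x1; apply: val_inj; rewrite [LHS]val_clamp min_l// max_r. Qed.

Lemma val_I01_continuous : continuous (set_val : I01 R -> R).
Proof. exact: initial_continuous. Qed.

Lemma clamp_continuous : continuous clamp.
Proof.
apply: continuous_comp_initial => x.
apply: continuous_max; first exact: cvg_cst.
by apply: continuous_min; [exact: cvg_cst|exact: cvg_id].
Qed.

Lemma I01_locally_compact : locally_compact [set: I01 R].
Proof.
move=> x _; exists setT; first exact: filterT.
by split; [exact: I01_compact|exact: closedT].
Qed.

End unit_interval.

Section continuous_at_real.
Variables (R : realType) (S : topologicalType) (x : S).

Lemma continuous_at_add (f g : S -> R) : continuous_at x f ->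
  continuous_at x g -> continuous_at x (fun y => f y + g y).
Proof. exact: cvgD. Qed.

Lemma continuous_at_opp (f : S -> R) : continuous_at x f ->
  continuous_at x (fun y => - f y).
Proof. exact: cvgN. Qed.

Lemma continuous_at_mul (f g : S -> R) : continuous_at x f ->
  continuous_at x g -> continuous_at x (fun y => f y * g y).
Proof. exact: cvgM. Qed.

Lemma continuous_at_max (f g : S -> R) : continuous_at x f ->
  continuous_at x g -> continuous_at x (fun y => Num.max (f y) (g y)).
Proof. exact: continuous_max. Qed.

Lemma continuous_at_min (f g : S -> R) : continuous_at x f ->
  continuous_at x g -> continuous_at x (fun y => Num.min (f y) (g y)).
Proof. exact: continuous_min. Qed.

Lemma continuous_at_clamp (f : S -> R) : continuous_at x f ->
  continuous_at x (fun y => clamp (f y)).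
Proof. by move=> cf; exact: continuous_at_comp cf (@clamp_continuous R _). Qed.

Lemma continuous_at_val (f : S -> I01 R) : continuous_at x f ->
  continuous_at x (fun y => set_val (f y)).
Proof.
by move=> cf; exact: continuous_at_comp cf (@val_I01_continuous R _).
Qed.

Lemma continuous_at_proj1 (T U : topologicalType) (f : S -> T * U) :
  continuous_at x f -> continuous_at x (fun y => (f y).1).
Proof. by move=> cf; exact: continuous_at_comp cf (@continuous_at_fst _ _ _). Qed.

Lemma continuous_at_proj2 (T U : topologicalType) (f : S -> T * U) :
  continuous_at x f -> continuous_at x (fun y => (f y).2).
Proof. by move=> cf; exact: continuous_at_comp cf (@continuous_at_snd _ _ _). Qed.

End continuous_at_real.

Ltac continuous_tac :=
  repeat first
    [ assumption | exact: continuous_at_cst | exact: cvg_id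
    | refine (continuous_at_add _ _) | refine (continuous_at_opp _)
    | refine (continuous_at_mul _ _) | refine (continuous_at_max _ _)
    | refine (continuous_at_min _ _) | refine (continuous_at_clamp _)
    | refine (continuous_at_pair _ _)
    | refine (continuous_at_val _)
    | refine (continuous_at_proj1 _) | refine (continuous_at_proj2 _) ].

(** * Homotopies and lifts up to homotopy *)

Section homotopies.
Variables (R : realType) (X : topologicalType).
Implicit Types Z : topologicalType.

Definition htpy_rev Z (W : Z * I01 R -> X) (zr : Z * I01 R) : X :=
  W (zr.1, clamp (1 - set_val zr.2)).

Definition htpy_cat Z (V W : Z * I01 R -> X) (zr : Z * I01 R) : X :=
  if set_val zr.2 - 1 / 2 <= 0 then V (zr.1, clamp (2 * set_val zr.2))
  else W (zr.1, clamp (2 * set_val zr.2 - 1)).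

Lemma htpy_rev_continuous Z (W : Z * I01 R -> X) z :
  (forall r, continuous_at (z, r) W) ->
  forall r, continuous_at (z, r) (htpy_rev W).
Proof.
by move=> cW r; refine (continuous_at_comp (g := W) _ (cW _)); continuous_tac.
Qed.

Lemma htpy_rev0 Z (W : Z * I01 R -> X) z : htpy_rev W (z, i0 R) = W (z, i1 R).
Proof. by rewrite /htpy_rev/= clamp_ge1// subr0. Qed.

Lemma htpy_rev1 Z (W : Z * I01 R -> X) z : htpy_rev W (z, i1 R) = W (z, i0 R).
Proof. by rewrite /htpy_rev/= clamp_le0// subrr. Qed.

Lemma htpy_catl Z (V W : Z * I01 R -> X) z r : set_val r <= 1 / 2 ->
  htpy_cat V W (z, r) = V (z, clamp (2 * set_val r)).
Proof. by move=> r2; rewrite /htpy_cat /= subr_le0 r2. Qed.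

Lemma htpy_catr Z (V W : Z * I01 R -> X) z r : V (z, i1 R) = W (z, i0 R) ->
  1 / 2 <= set_val r ->
  htpy_cat V W (z, r) = W (z, clamp (2 * set_val r - 1)).
Proof.
move=> VW; rewrite le_eqVlt => /orP[/eqP r2|r2].
  rewrite htpy_catl -?r2// clamp_ge1; last by lra.
  by rewrite clamp_le0//; lra.
by rewrite /htpy_cat /= subr_le0 leNgt r2.
Qed.

Lemma htpy_cat_continuous Z (V W : Z * I01 R -> X) z :
  (forall r, continuous_at (z, r) V) -> (forall r, continuous_at (z, r) W) ->
  V (z, i1 R) = W (z, i0 R) ->
  forall r, continuous_at (z, r) (htpy_cat V W).
Proof.
move=> cV cW VW r; apply: continuous_at_if => /=.
- by continuous_tac.
- move=> _; refine (continuous_at_comp (g := V) _ (cV _)); continuous_tac.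
- move=> _; refine (continuous_at_comp (g := W) _ (cW _)); continuous_tac.
- move=> r2; rewrite clamp_ge1; last by lra.
  by rewrite clamp_le0//; lra.
Qed.

Lemma htpy_cat0 Z (V W : Z * I01 R -> X) z :
  htpy_cat V W (z, i0 R) = V (z, i0 R).
Proof. by rewrite htpy_catl val_i0 ?clamp_le0//; lra. Qed.

Lemma htpy_cat1 Z (V W : Z * I01 R -> X) z : V (z, i1 R) = W (z, i0 R) ->
  htpy_cat V W (z, i1 R) = W (z, i1 R).
Proof. by move=> VW; rewrite htpy_catr// val_i1 ?clamp_ge1//; lra. Qed.

Lemma homotopic_refl Z (f : Z -> X) : continuous f -> homotopic R f f.
Proof.
move=> cf; exists (fun zr => f zr.1); split=> // zr.
by refine (continuous_at_comp (g := f) _ (cf _)); continuous_tac.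
Qed.

Lemma homotopic_sym Z (f g : Z -> X) : homotopic R f g -> homotopic R g f.
Proof.
move=> [W [cW W0 W1]]; exists (htpy_rev W).
split=> [[z r]|z|z]; first by apply: htpy_rev_continuous.
- by rewrite htpy_rev0.
- by rewrite htpy_rev1.
Qed.

Lemma homotopic_trans Z (g f h : Z -> X) :
  homotopic R f g -> homotopic R g h -> homotopic R f h.
Proof.
move=> [V [cV V0 V1]] [W [cW W0 W1]]; exists (htpy_cat V W).
have VW z : V (z, i1 R) = W (z, i0 R) by rewrite V1 W0.
split=> [[z r]|z|z]; first exact: htpy_cat_continuous.
- by rewrite htpy_cat0.
- by rewrite htpy_cat1.
Qed.

Lemma homotopic_postcomp Z (Y : topologicalType) (h : X -> Y) (f g : Z -> X) :
  continuous h -> homotopic R f g -> homotopic R (h \o f) (h \o g).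
Proof.
move=> ch [W [cW W0 W1]]; exists (h \o W); split=> [zr|z|z] /=.
- exact: continuous_at_comp (cW _) (ch _).
- by rewrite W0.
- by rewrite W1.
Qed.

Lemma homotopic_precomp Z (Y : topologicalType) (h : Y -> Z) (f g : Z -> X) :
  continuous h -> homotopic R f g -> homotopic R (f \o h) (g \o h).
Proof.
move=> ch [W [cW W0 W1]]; exists (fun yr => W (h yr.1, yr.2)).
split=> [yr|y|y] /=; [|by rewrite W0|by rewrite W1].
refine (continuous_at_comp (g := W) _ (cW _)).
apply: continuous_at_pair; last by continuous_tac.
by refine (continuous_at_comp (g := h) _ (ch _)); continuous_tac.
Qed.

End homotopies.

Section lifts.
Variables (R : realType) (X : topologicalType).

(* [u] is a total function, but its values outside [D] are junk. *)
Definition lift_on (Z E : topologicalType) (phi : Z -> X) (p : E -> X)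
    (D : set Z) (u : Z -> E) : Prop :=
  (forall z, D z -> continuous_at z u) /\
  exists H : Z * I01 R -> X, forall z, D z ->
    [/\ forall r, continuous_at (z, r) H, H (z, i0 R) = p (u z)
      & H (z, i1 R) = phi z].

Lemma lift_onS (Z E : topologicalType) (phi : Z -> X) (p : E -> X)
    (D D' : set Z) (u : Z -> E) :
  D' `<=` D -> lift_on phi p D u -> lift_on phi p D' u.
Proof.
move=> DD' [cu [H HD]]; split=> [z /DD'|]; first exact: cu.
by exists H => z /DD'; exact: HD.
Qed.

Lemma lift_on_setT (Z E : topologicalType) (phi : Z -> X) (p : E -> X)
    (u : Z -> E) :
  lift_on phi p setT u <-> continuous u /\ homotopic R (p \o u) phi.
Proof.
split=> [[cu [H HD]]|[cu [H [cH H0 H1]]]].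
  split=> [z|]; first exact: cu.
  by exists H; split=> [[z r]|z|z]; have [] := HD z I.
by split=> [z _|]; [exact: cu|exists H].
Qed.

(** The homotopy of [u'] pulled back along [u], followed by that of [u]. This produces lifts through
    nested joins. *)
Lemma lift_on_comp (Z E E' : topologicalType) (phi : Z -> X) (p : E -> X)
    (p' : E' -> X) (D : set Z) (D' : set E) (u : Z -> E) (u' : E -> E') :
  lift_on phi p D u -> lift_on p p' D' u' ->
  lift_on phi p' (D `&` u @^-1` D') (u' \o u).
Proof.
move=> [cu [H HD]] [cu' [H' HD']]; split=> [z [/= Dz D'z]|].
  exact: continuous_at_comp (cu _ Dz) (cu' _ D'z).
pose V (zr : Z * I01 R) := H' (u zr.1, zr.2).
exists (htpy_cat V H) => z [/= Dz D'z].
have [cH H0 H1] := HD _ Dz; have [cH' H'0 H'1] := HD' _ D'z.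
have VH : V (z, i1 R) = H (z, i0 R) by rewrite /V /= H'1 H0.
split.
- apply: htpy_cat_continuous => // r.
  refine (continuous_at_comp (g := H') _ (cH' _)).
  apply: continuous_at_pair; last by continuous_tac.
  by refine (continuous_at_comp (g := u) _ (cu _ Dz)); continuous_tac.
- by rewrite htpy_cat0.
- by rewrite htpy_cat1.
Qed.

End lifts.

(** * Joins over a base *)

Section join.
Variables (R : realType) (X E F : topologicalType) (p : E -> X) (q : F -> X).

Definition join_space : topologicalType :=
  hpushout R (hpb_fst R p q) (hpb_snd R p q).

Definition join_map : join_space -> X :=
  hpo_map R (hpb_fst R p q) (hpb_snd R p q) p q (hpb_htpy R p q).

Definition join_inl : E -> join_space :=
  hpo_inl R (hpb_fst R p q) (hpb_snd R p q).

Definition join_inr : F -> join_space :=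
  hpo_inr R (hpb_fst R p q) (hpb_snd R p q).

Definition is_hpb (z : E * {compact-open, I01 R -> X} * F) : Prop :=
  [/\ continuous (z.1.2 : I01 R -> X),
      z.1.2 (i0 R) = p z.1.1 & z.1.2 (i1 R) = q z.2].

Definition hpb_mk (z : E * {compact-open, I01 R -> X} * F) (Pz : is_hpb z) :
  hpullback R p q := exist _ z (mem_set Pz).

Lemma hpb_htpy0 x : hpb_htpy R p q (x, i0 R) = p (hpb_fst R p q x).
Proof. by have [] := set_valP x. Qed.

Lemma hpb_htpy1 x : hpb_htpy R p q (x, i1 R) = q (hpb_snd R p q x).
Proof. by have [] := set_valP x. Qed.

Lemma hpb_fst_continuous : continuous (hpb_fst R p q).
Proof.
move=> z; do 2 refine (continuous_at_proj1 _).
exact: initial_continuous.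
Qed.

Lemma hpb_snd_continuous : continuous (hpb_snd R p q).
Proof. by move=> z; refine (continuous_at_proj2 _); exact: initial_continuous. Qed.

Lemma join_mapE s : join_map (hpo_pi _ _ s) = cyl_sum_map p q (hpb_htpy R p q) s.
Proof. by apply: hpo_mapE; [exact: hpb_htpy0|exact: hpb_htpy1]. Qed.

Lemma join_map_inl e : join_map (join_inl e) = p e.
Proof. exact: join_mapE. Qed.

Lemma join_map_inr f : join_map (join_inr f) = q f.
Proof. exact: join_mapE. Qed.

Lemma join_map_continuous : continuous p -> continuous q -> continuous join_map.
Proof.
move=> cp cq; apply: hpo_map_continuous => //.
- exact: hpb_htpy0.
- exact: hpb_htpy1.
- exact: hpb_htpy_continuous.
Qed.

Lemma join_pi_continuous :
  continuous (hpo_pi (hpb_fst R p q) (hpb_snd R p q) : _ -> join_space).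
Proof. exact: pi_continuous. Qed.

Lemma join_inl_continuous : continuous join_inl.
Proof.
move=> e; refine (continuous_at_comp _ (@join_pi_continuous _)).
exact: (@existT_continuous _ (cyl_piece R _ E F) (Some true)).
Qed.

Lemma join_inr_continuous : continuous join_inr.
Proof.
move=> e; refine (continuous_at_comp _ (@join_pi_continuous _)).
exact: (@existT_continuous _ (cyl_piece R _ E F) (Some false)).
Qed.

Lemma join_pi0 x : hpo_pi _ _ (cyl_mid E F (x, i0 R)) = join_inl (hpb_fst R p q x).
Proof.
apply/eqmodP/asboolP; apply: Relation_Operators.rst_step; exact: CylGlue0.
Qed.

Lemma join_pi1 x : hpo_pi _ _ (cyl_mid E F (x, i1 R)) = join_inr (hpb_snd R p q x).
Proof.
apply/eqmodP/asboolP; apply: Relation_Operators.rst_step; exact: CylGlue1.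
Qed.

(* The value off [is_hpb] is junk. *)
Definition join_mid (z : E * {compact-open, I01 R -> X} * F) (s : I01 R) :
    join_space :=
  match pselect (is_hpb z) with
  | left Pz => hpo_pi _ _ (cyl_mid E F (hpb_mk Pz, s))
  | right _ => join_inl z.1.1
  end.

Lemma join_midE z (Pz : is_hpb z) s :
  join_mid z s = hpo_pi _ _ (cyl_mid E F (hpb_mk Pz, s)).
Proof.
rewrite /join_mid; case: pselect => // Pz'.
by congr (hpo_pi _ _ (cyl_mid _ _ (_, _))); apply: val_inj.
Qed.

Lemma join_mid0 z : is_hpb z -> join_mid z (i0 R) = join_inl z.1.1.
Proof. by move=> Pz; rewrite (join_midE Pz) join_pi0. Qed.

Lemma join_mid1 z : is_hpb z -> join_mid z (i1 R) = join_inr z.2.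
Proof. by move=> Pz; rewrite (join_midE Pz) join_pi1. Qed.

Lemma join_map_mid z s : is_hpb z -> join_map (join_mid z s) = z.1.2 s.
Proof. by move=> Pz; rewrite (join_midE Pz) join_mapE. Qed.

(** Since [b] lies in the homotopy pullback only near [z0], it is replaced by a total map [g] into
    that subspace, with default value [b z0]; the two agree near [z0]. *)
Lemma join_mid_continuous (Z : topologicalType) z0
    (b : Z -> E * {compact-open, I01 R -> X} * F) (s : Z -> I01 R) :
  continuous_at z0 b -> continuous_at z0 s ->
  (\forall z \near z0, is_hpb (b z)) ->
  continuous_at z0 (fun z => join_mid (b z) (s z)).
Proof.
move=> cb cs Pb; pose x0 := hpb_mk (nbhs_singleton Pb).
pose g z : hpullback R p q := insubd x0 (b z).
have gE z (Pz : is_hpb (b z)) : g z = hpb_mk Pz.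
  by apply: val_inj; rewrite /g val_insubd mem_set.
have cg : continuous_at z0 g.
  move=> W; rewrite {1}(gE _ (nbhs_singleton Pb)) => -[V [[V' oV' <-] V'b VW]].
  have V'z : nbhs z0 (b @^-1` V') by apply: cb; exact: open_nbhs_nbhs.
  by apply: filterS2 (Pb) V'z => z Pz V'z; apply: VW; rewrite /= (gE _ Pz).
apply: (@continuous_at_near _ _ (fun z => hpo_pi _ _ (cyl_mid E F (g z, s z)))).
  by apply: filterS (Pb) => z Pz; rewrite (join_midE Pz) gE.
refine (continuous_at_comp _ (@join_pi_continuous _)).
refine (continuous_at_comp (g := @cyl_mid R (hpullback R p q) E F) _ _).
  exact: continuous_at_pair cg cs.
exact: (@existT_continuous _ (cyl_piece R _ E F) None).
Qed.

(** Where [0 < t < 1], following [H] from [p (u z)] to [phi z] and then [K] backwards to [q (v z)]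
    gives a path [om], hence a point of the homotopy pullback. The last clause keeps track of maps
    into the join that factor through [E]. A proper open [D] serves associativity, which first glues
    over a part of the source. *)
Lemma join_lift (Z : topologicalType) (phi : Z -> X) (D : set Z) (t : Z -> R)
    (u : Z -> E) (v : Z -> F) :
  open D -> (forall z, D z -> continuous_at z t) ->
  lift_on R phi p (D `&` [set z | t z < 1]) u ->
  lift_on R phi q (D `&` [set z | 0 < t z]) v ->
  exists2 w : Z -> join_space, lift_on R phi join_map D w &
    forall z, t z <= 0 -> w z = join_inl (u z).
Proof.
move=> oD ct [cu [H HD]] [cv [K KD]].
pose om := htpy_cat H (htpy_rev K).
have HK z : D z -> 0 < t z < 1 -> H (z, i1 R) = htpy_rev K (z, i0 R).
  move=> Dz /andP[t0 t1]; rewrite htpy_rev0.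
  by have [//|_ _ ->] := HD z; have [//|_ _ ->] := KD z.
have com z r : D z -> 0 < t z < 1 -> continuous_at (z, r) om.
  move=> Dz t01; have /andP[t0 t1] := t01.
  have [//|cH _ _] := HD z; have [//|cK _ _] := KD z.
  by apply: htpy_cat_continuous => //; [exact: htpy_rev_continuous|exact: HK].
pose b z : E * {compact-open, I01 R -> X} * F :=
  (u z, (fun r => om (z, r)) : {compact-open, I01 R -> X}, v z).
have Pb z : D z -> 0 < t z < 1 -> is_hpb (b z).
  move=> Dz t01; have /andP[t0 t1] := t01.
  have [//|cH H0 _] := HD z; have [//|cK K0 _] := KD z.
  split=> /=.
  - move=> r; refine (continuous_at_comp (g := om) _ (com _ _ _ _)) => //.
    by continuous_tac.
  - by rewrite /om htpy_cat0.
  - by rewrite /om htpy_cat1 ?htpy_rev1//; exact: HK.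
pose s z := 3 * t z - 1.
have ct3 c z : D z -> continuous_at z (fun y => t y - c).
  by move=> Dz; have ctz := ct _ Dz; continuous_tac.
have cs z : D z -> continuous_at z s.
  by move=> Dz; have ctz := ct _ Dz; rewrite /s; continuous_tac.
(* The cylinder is crossed while [t] runs from 1/3 to 2/3, so both lifts exist around the places
   where the branches meet. *)
pose w z := if t z - 1 / 3 <= 0 then join_inl (u z) else
  if t z - 2 / 3 <= 0 then join_mid (b z) (clamp (s z)) else join_inr (v z).
exists w; last first.
  by move=> z t0; rewrite /w ifT//; lra.
have cb z : D z -> 0 < t z < 1 -> continuous_at z b.
  move=> Dz t01; have /andP[t0 t1] := t01.
  apply: continuous_at_pair; last by apply: cv; split.
  apply: continuous_at_pair; first by apply: cu; split.
  by apply: continuous_at_curry => r; exact: com.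
split=> [z Dz|].
- have cmid : 0 < t z < 1 ->
      continuous_at z (fun y => join_mid (b y) (clamp (s y))).
    move=> t01; have /andP[t0 t1] := t01.
    apply: join_mid_continuous; [exact: cb| |].
      exact: continuous_at_clamp (cs _ Dz).
    have Dnear : nbhs z D by exact: open_nbhs_nbhs.
    near=> y; apply: Pb; first by near: y.
    apply/andP; split; near: y.
      exact: cvgr_gt _ (ct _ Dz) _ t0.
    exact: cvgr_lt _ (ct _ Dz) _ t1.
  apply: continuous_at_if; first exact: ct3.
  + move=> tz; refine (continuous_at_comp (cu _ _) (@join_inl_continuous _)).
    by split=> //=; lra.
  + move=> tz; apply: continuous_at_if; first exact: ct3.
    * by move=> tz'; apply: cmid; lra.
    * move=> tz'; refine (continuous_at_comp (cv _ _) (@join_inr_continuous _)).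
      by split=> //=; lra.
    * move=> tz'; rewrite clamp_ge1; last by rewrite /s; lra.
      by rewrite join_mid1//; apply: Pb => //; lra.
  + move=> tz; rewrite ifT; last by lra.
    rewrite clamp_le0; last by rewrite /s; lra.
    by rewrite join_mid0//; apply: Pb => //; lra.
(* On the middle third [w] projects to [om] at time [s]; [L] slides this time affinely to 1/2, where
   [om] passes through [phi]. *)
pose L (zr : Z * I01 R) := if t zr.1 - 1 / 3 <= 0 then H zr else
  if t zr.1 - 2 / 3 <= 0 then
    om (zr.1, clamp ((1 - set_val zr.2) * s zr.1 + set_val zr.2 * (1 / 2)))
  else K zr.
exists L => z Dz.
(* The branches of [L] agree: at [t = 1/3] the slide traverses the first half of [om], which is [H],
   and at [t = 2/3] the second half backwards, which is [K]. *)
have omH r : 0 < t z < 1 -> om (z, clamp (set_val r * (1 / 2))) = H (z, r).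
  move=> t01; have r0 := I01_ge0 r; have r1 := I01_le1 r.
  have rE : set_val (clamp (set_val r * (1 / 2))) = set_val r * (1 / 2).
    by apply: clampE; lra.
  rewrite /om htpy_catl rE; last by lra.
  by rewrite (_ : 2 * _ = set_val r) ?clamp_val//; lra.
have omK r : 0 < t z < 1 ->
    om (z, clamp (1 - set_val r + set_val r * (1 / 2))) = K (z, r).
  move=> t01; have r0 := I01_ge0 r; have r1 := I01_le1 r.
  have rE : set_val (clamp (1 - set_val r + set_val r * (1 / 2))) =
      1 - set_val r + set_val r * (1 / 2) by apply: clampE; lra.
  rewrite /om htpy_catr ?rE; [|exact: HK|by lra].
  rewrite /htpy_rev /= clampE; last by lra.
  by rewrite (_ : 1 - (_ - 1) = set_val r) ?clamp_val//; lra.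
have ctf (c : R) (r : I01 R) : continuous_at (z, r) (fun zr => t zr.1 - c).
  exact: (@continuous_at_comp _ _ _ fst (fun y => t y - c) (z, r)
    (@continuous_at_fst _ _ _) (ct3 c z Dz)).
have HDz (tz : t z < 1) := HD z (conj Dz tz).
have KDz (tz : 0 < t z) := KD z (conj Dz tz).
split=> [r||].
- apply: continuous_at_if => /=; first exact: ctf.
  + by move=> tz; have [|] := HDz; first by lra.
  + move=> tz; apply: continuous_at_if => /=; first exact: ctf.
    * move=> tz'; refine (continuous_at_comp (g := om) _ (com _ _ Dz _)).
        have csf : continuous_at (z, r) (fun zr => s zr.1).
          exact: (@continuous_at_comp _ _ _ fst s (z, r)
            (@continuous_at_fst _ _ _) (cs z Dz)).
        by continuous_tac.
      by lra.
    * by move=> tz'; have [|] := KDz; first by lra.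
    * move=> tz'; rewrite (_ : s z = 1); last by rewrite /s; lra.
      by rewrite mulr1 omK//; lra.
  + move=> tz; rewrite ifT; last by lra.
    rewrite (_ : s z = 0); last by rewrite /s; lra.
    by rewrite mulr0 add0r omH//; lra.
- rewrite /L /w /=; case: lerP => tz.
    by rewrite join_map_inl; have [|] := HDz; first by lra.
  case: lerP => tz'.
    rewrite join_map_mid; last by apply: Pb => //; lra.
    by rewrite /b /= subr0 mul1r mul0r addr0.
  by rewrite join_map_inr; have [|] := KDz; first by lra.
- rewrite /L /=; case: lerP => tz.
    by have [|] := HDz; first by lra.
  case: lerP => tz'.
    have t01 : 0 < t z < 1 by lra.
    rewrite subrr mul0r add0r omH//.
    by have [|] := HDz; first by lra.
  by have [|] := KDz; first by lra.
Unshelve. all: by end_near. Qed.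
End join.

Arguments join_map R {X E F} p q z.
Arguments join_inl R {X E F} p q e.
Arguments join_inr R {X E F} p q f.

(** * The cover carried by a join *)

Section join_cover.
Variables (R : realType) (X E F : topologicalType) (p : E -> X) (q : F -> X).
Local Notation J := (join_space R p q).
Local Notation jpi := (hpo_pi (hpb_fst R p q) (hpb_snd R p q)).

Lemma join_ind (P : J -> Prop) : (forall s, P (jpi s)) -> forall z, P z.
Proof.
move=> Ps z; pose Q := {eq_quot cyl_rel R (hpb_fst R p q) (hpb_snd R p q)}.
by have := Ps (repr (z : Q)); rewrite /hpo_pi reprK.
Qed.

(** Openness in the join is openness of the preimage under [jpi], so continuity has to be tested on
    a whole open set [D] and not at one point. *)
Lemma join_continuous_at (Y : topologicalType) (D : set J) (f : J -> Y) :
  open D -> (forall s, D (jpi s) -> continuous_at s (f \o jpi)) ->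
  forall z, D z -> continuous_at z f.
Proof.
move=> oD cf z Dz W; rewrite nbhsE => -[U [oU Ufz] UW].
have oDU : open (D `&` f @^-1` U).
  rewrite /open/= /quotient_open openE => s [Ds Us].
  apply: filterI.
    apply: (@join_pi_continuous R X E F p q s).
    exact: open_nbhs_nbhs.
  by apply: cf => //; exact: open_nbhs_nbhs.
have : nbhs z (D `&` f @^-1` U) by exact: open_nbhs_nbhs.
by apply: filterS => y [_ /UW].
Qed.

(* Affine in the join parameter and normalised so that the lifts [join_lft] and
   [join_rgt] below live over {weight < 1} and {weight > 0}, i.e. over the
   parameters < 2/3 and > 1/3. *)
Definition join_weight : J -> R :=
  hpo_map R (hpb_fst R p q) (hpb_snd R p q) (fun=> - 1 : R) (fun=> 2 : R)
    (fun xs => 3 * set_val xs.2 - 1).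

Lemma join_weightE s : join_weight (jpi s) =
  cyl_sum_map (fun=> - 1 : R) (fun=> 2 : R) (fun xs => 3 * set_val xs.2 - 1) s.
Proof. by apply: hpo_mapE => x /=; rewrite ?val_i0 ?val_i1; lra. Qed.

Lemma join_weight_continuous : continuous join_weight.
Proof.
apply: hpo_map_continuous => [x|x|x|x|x] /=; rewrite ?val_i0 ?val_i1; try lra.
- exact: continuous_at_cst.
- exact: continuous_at_cst.
- by continuous_tac.
Qed.

(** The default [e0] is used on [F] and at parameter 1, where no point of [E] is at hand; the jump
    stays outside {weight < 1}. *)
Definition join_lft (e0 : E) : J -> E :=
  hpo_map R (hpb_fst R p q) (hpb_snd R p q) id (fun=> e0)
    (fun xs => if set_val xs.2 < 1 then hpb_fst R p q xs.1 else e0).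

Lemma join_lftE e0 s : join_lft e0 (jpi s) =
  cyl_sum_map id (fun=> e0)
    (fun xs => if set_val xs.2 < 1 then hpb_fst R p q xs.1 else e0) s.
Proof.
by apply: hpo_mapE => x /=; rewrite ?val_i0 ?val_i1 ?ltr01 ?ltxx.
Qed.

Definition join_rgt (f0 : F) : J -> F :=
  hpo_map R (hpb_fst R p q) (hpb_snd R p q) (fun=> f0) id
    (fun xs => if 0 < set_val xs.2 then hpb_snd R p q xs.1 else f0).

Lemma join_rgtE f0 s : join_rgt f0 (jpi s) =
  cyl_sum_map (fun=> f0) id
    (fun xs => if 0 < set_val xs.2 then hpb_snd R p q xs.1 else f0) s.
Proof.
by apply: hpo_mapE => x /=; rewrite ?val_i0 ?val_i1 ?ltr01 ?ltxx.
Qed.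

Lemma join_lft_continuous e0 z :
  join_weight z < 1 -> continuous_at z (join_lft e0).
Proof.
apply: (join_continuous_at (D := [set z | join_weight z < 1])).
  apply: (@open_comp _ _ join_weight [set r | r < 1]); last exact: open_lt.
  by move=> ? _; exact: join_weight_continuous.
move=> s /=; rewrite join_weightE.
have -> : join_lft e0 \o jpi = cyl_sum_map id (fun=> e0)
    (fun xs => if set_val xs.2 < 1 then hpb_fst R p q xs.1 else e0).
  by apply/funext => y; rewrite -join_lftE.
case: s => -[[]|] /= y ty W Wy.
- exact: Wy.
- by exfalso; lra.
apply: (_ : continuous_at y (fun xs : hpullback R p q * I01 R =>
  if set_val xs.2 < 1 then hpb_fst R p q xs.1 else e0)) => //.
have cy : continuous_at y (fun xs : hpullback R p q * I01 R => set_val xs.2).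
  by continuous_tac.
apply: (@continuous_at_near _ _ (fun xs => hpb_fst R p q xs.1)).
  have y1 : set_val y.2 < 1 by lra.
  by apply: filterS (cvgr_lt _ cy _ y1) => x /= ->.
exact: (continuous_at_comp (@continuous_at_fst _ _ _)
  (@hpb_fst_continuous _ _ _ _ _ _ _)).
Qed.

Lemma join_rgt_continuous f0 z :
  0 < join_weight z -> continuous_at z (join_rgt f0).
Proof.
apply: (join_continuous_at (D := [set z | 0 < join_weight z])).
  apply: (@open_comp _ _ join_weight [set r | 0 < r]); last exact: open_gt.
  by move=> ? _; exact: join_weight_continuous.
move=> s /=; rewrite join_weightE.
have -> : join_rgt f0 \o jpi = cyl_sum_map (fun=> f0) id
    (fun xs => if 0 < set_val xs.2 then hpb_snd R p q xs.1 else f0).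
  by apply/funext => y; rewrite -join_rgtE.
case: s => -[[]|] /= y ty W Wy.
- by exfalso; lra.
- exact: Wy.
apply: (_ : continuous_at y (fun xs : hpullback R p q * I01 R =>
  if 0 < set_val xs.2 then hpb_snd R p q xs.1 else f0)) => //.
have cy : continuous_at y (fun xs : hpullback R p q * I01 R => set_val xs.2).
  by continuous_tac.
apply: (@continuous_at_near _ _ (fun xs => hpb_snd R p q xs.1)).
  have y1 : 0 < set_val y.2 by lra.
  by apply: filterS (cvgr_gt _ cy _ y1) => x /= ->.
exact: (continuous_at_comp (@continuous_at_fst _ _ _)
  (@hpb_snd_continuous _ _ _ _ _ _ _)).
Qed.

Hypotheses (cp : continuous p) (cq : continuous q).

Let slide (rho : R -> R) (xs : hpullback R p q * I01 R) :
    {compact-open, I01 R -> X} :=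
  fun r => hpb_htpy R p q
    (xs.1,
     clamp ((1 - set_val r) * rho (set_val xs.2) + set_val r * set_val xs.2)).

(* Moves a point with parameter s to the one with parameter [rho s] along its
   path in X; choosing [rho] constant near 0 (resp. 1) makes the initial map
   factor there through E (resp. F). *)
Lemma join_slide (rho : R -> R) : continuous rho -> rho 0 = 0 -> rho 1 = 1 ->
  exists H : J * I01 R -> X,
    [/\ continuous H,
        forall z, H (z, i1 R) = join_map R p q z
      & forall s, H (jpi s, i0 R) =
          cyl_sum_map p q
            (fun xs => hpb_htpy R p q (xs.1, clamp (rho (set_val xs.2)))) s].
Proof.
move=> crho rho0 rho1.
pose cst_path (x : X) : {compact-open, I01 R -> X} := fun=> x.
(* The homotopy is built as a map from the join to the path space, where the quotient property gives
   continuity, and then uncurried. This avoids the product of a quotient with the interval. *)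
pose P : J -> {compact-open, I01 R -> X} :=
  hpo_map R (hpb_fst R p q) (hpb_snd R p q)
    (cst_path \o p) (cst_path \o q) (slide rho).
have s0 x : slide rho (x, i0 R) = (cst_path \o p) (hpb_fst R p q x).
  apply/funext => r; rewrite /slide /= rho0 !mulr0 addr0 clamp_le0//.
  exact: hpb_htpy0.
have s1 x : slide rho (x, i1 R) = (cst_path \o q) (hpb_snd R p q x).
  apply/funext => r; rewrite /slide /= rho1 !mulr1 subrK clamp_ge1//.
  exact: hpb_htpy1.
have PE s :
    P (jpi s) = cyl_sum_map (cst_path \o p) (cst_path \o q) (slide rho) s.
  exact: hpo_mapE.
have cslide : continuous (fun y : (hpullback R p q * I01 R) * I01 R =>
    slide rho y.1 y.2).
  move=> y; refine (continuous_at_comp (g := hpb_htpy R p q) _ _); last first.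
    exact: hpb_htpy_continuous.
  have crhoy : continuous_at y (fun y => rho (set_val y.1.2)).
    apply: (@continuous_at_comp _ _ _
      (fun y : (hpullback R p q * I01 R) * I01 R => set_val y.1.2) rho) => //.
    by continuous_tac.
  by continuous_tac.
have cP : continuous P.
  apply: hpo_map_continuous => //.
  - move=> e.
    apply: (@continuous_at_curry _ _ _ (fun er : E * I01 R => p er.1)) => r.
    exact: (@continuous_at_comp _ _ _ (fst : E * I01 R -> E) p (e, r)
      (@continuous_at_fst _ _ _) (@cp _)).
  - move=> f.
    apply: (@continuous_at_curry _ _ _ (fun er : F * I01 R => q er.1)) => r.
    exact: (@continuous_at_comp _ _ _ (fst : F * I01 R -> F) q (f, r)
      (@continuous_at_fst _ _ _) (@cq _)).
  - move=> x; apply: (@continuous_at_curry _ _ _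
      (fun y : (hpullback R p q * I01 R) * I01 R => slide rho y.1 y.2)) => r.
    exact: cslide.
have cPz z : continuous (P z : I01 R -> X).
  elim/join_ind: z => s; rewrite PE.
  case: s => -[[]|] y r /=.
  - exact: (@continuous_at_cst _ _ r (p y)).
  - exact: (@continuous_at_cst _ _ r (q y)).
  apply: (@continuous_at_comp _ _ _ (fun r : I01 R => (y, r))
    (fun y => slide rho y.1 y.2)); last exact: cslide.
  by continuous_tac.
exists (uncurry (P : J -> I01 R -> X)); split.
- apply: continuous_uncurry => //.
    exact: I01_locally_compact.
  exact: I01_hausdorff.
- elim/join_ind => s; rewrite /uncurry /= PE join_mapE.
  case: s => -[[]|] // [y r]; rewrite /= /slide /=.
  by rewrite val_i1 subrr mul0r mul1r add0r clamp_val.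
- move=> s; rewrite /uncurry /= PE.
  case: s => -[[]|] // [y r]; rewrite /= /slide /=.
  by rewrite val_i0 subr0 mul0r mul1r addr0.
Qed.

Lemma join_lft_lift e0 :
  lift_on R (join_map R p q) p [set z : J | join_weight z < 1] (join_lft e0).
Proof.
split=> [z /= tz|]; first exact: join_lft_continuous.
(* This [rho] vanishes for [s <= 2/3], hence over {weight < 1}, so there the slide starts at [p] of
   the [E] coordinate. *)
have [|||H [cH H1 H0]] := @join_slide (fun s => Num.max 0 (3 * s - 2)).
- by move=> s; continuous_tac.
- by rewrite max_l//; lra.
- by rewrite max_r; lra.
exists H; elim/join_ind => s ts; split=> //; rewrite H0 join_lftE.
move: ts; rewrite /= join_weightE.
case: s => -[[]|] y /= tr //; first by exfalso; lra.
rewrite max_l ?clamp_le0//; last by lra.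
by case: y tr => y r /= tr; rewrite ifT ?hpb_htpy0//; lra.
Qed.

Lemma join_rgt_lift f0 :
  lift_on R (join_map R p q) q [set z : J | 0 < join_weight z] (join_rgt f0).
Proof.
split=> [z /= tz|]; first exact: join_rgt_continuous.
have [|||H [cH H1 H0]] := @join_slide (fun s => Num.min 1 (3 * s)).
- by move=> s; continuous_tac.
- by rewrite min_r//; lra.
- by rewrite min_l; lra.
exists H; elim/join_ind => s ts; split=> //; rewrite H0 join_rgtE.
move: ts; rewrite /= join_weightE.
case: s => -[[]|] y /= tr //; first by exfalso; lra.
rewrite min_l ?clamp_ge1//; last by lra.
by case: y tr => y r /= tr; rewrite ifT ?hpb_htpy1//; lra.
Qed.

Lemma join_weight_inl e : join_weight (join_inl R p q e) = - 1.
Proof. exact: join_weightE. Qed.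

Lemma join_lft_inl e0 e : join_lft e0 (join_inl R p q e) = e.
Proof. exact: join_lftE. Qed.

End join_cover.

Arguments join_weight R {X E F} p q z.
Arguments join_lft R {X E F} p q e0 z.
Arguments join_rgt R {X E F} p q f0 z.

(** * Associativity of the join *)

Section domination.
Variables (R : realType) (X B : topologicalType).

(** With [id] on [X] for [p] and a map [f] for [i], this asks for a homotopy section of [q]
    compatible with [f]: the condition in both relative categories. *)
Definition dominated (E E' : topologicalType) (p : E -> X) (i : B -> E)
    (q : E' -> X) (j : B -> E') : Prop :=
  exists h : E -> E',
    [/\ continuous h, homotopic R (q \o h) p & homotopic R (h \o i) j].

Lemma dominated_refl (E : topologicalType) (p : E -> X) (i j : B -> E) :
  continuous p -> homotopic R i j -> dominated p i p j.
Proof.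
move=> cp ij; exists id; split=> //; first by move=> x; exact: cvg_id.
exact: homotopic_refl.
Qed.

Lemma dominated_trans (E E' E'' : topologicalType) (p : E -> X) (i : B -> E)
    (q : E' -> X) (j : B -> E') (r : E'' -> X) (k : B -> E'') :
  dominated p i q j -> dominated q j r k -> dominated p i r k.
Proof.
move=> [h [ch hp hi]] [h' [ch' h'p h'i]]; exists (h' \o h); split.
- by move=> x; exact: continuous_at_comp (ch _) (ch' _).
- exact: homotopic_trans (homotopic_precomp ch h'p) hp.
- exact: homotopic_trans (homotopic_postcomp ch' hi) h'i.
Qed.

Variables (E F : topologicalType) (p : E -> X) (q : F -> X) (i : B -> E).
Hypotheses (cp : continuous p) (cq : continuous q).
Variables (e0 : E) (f0 : F).

(** The source is covered by its lifts to [E] and [F]; the first is composed with [h], and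
    [join_lift] glues them. The weight is -1 on the image of [join_inl], so the glued map is [h]
    followed by [join_inl] there. *)
Lemma dominated_joinl (E' : topologicalType) (p' : E' -> X) (i' : B -> E') :
  dominated p i p' i' ->
  dominated (join_map R p q) (join_inl R p q \o i)
            (join_map R p' q) (join_inl R p' q \o i').
Proof.
move=> [h [ch hp hi]].
have lh : lift_on R p p' setT h by apply/lift_on_setT.
have ll := lift_on_comp (join_lft_lift R cp cq e0) lh.
have lr := join_rgt_lift R cp cq f0.
have [||||w /lift_on_setT[cw wJ] wE] := @join_lift R X E' F p' q _
    (join_map R p q) setT (join_weight R p q) (h \o join_lft R p q e0) (join_rgt R p q f0).
- exact: openT.
- by move=> z _; exact: join_weight_continuous.
- by apply: lift_onS ll => z [].
- by apply: lift_onS lr => z [].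
exists w; split=> //.
have -> : w \o (join_inl R p q \o i) = join_inl R p' q \o (h \o i).
  apply/funext => b; rewrite /= wE; last by rewrite join_weight_inl; lra.
  by rewrite /= join_lft_inl.
by apply: homotopic_postcomp hi; exact: join_inl_continuous.
Qed.

Hypothesis ci : continuous i.

Variables (A : topologicalType) (a : A -> X) (a0 : A).
Hypothesis ca : continuous a.

Lemma dominated_joinA :
  dominated (join_map R p (join_map R q a)) (join_inl R p (join_map R q a) \o i)
    (join_map R (join_map R p q) a)
    (join_inl R (join_map R p q) a \o (join_inl R p q \o i)).
Proof.
pose T := join_weight R p (join_map R q a); pose T1 := join_weight R q a.
pose l := join_lft R p (join_map R q a) e0.
pose r := join_rgt R p (join_map R q a) (join_inl R q a f0).
have cqa : continuous (join_map R q a) by exact: join_map_continuous.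
have cT : continuous T by exact: join_weight_continuous.
have cT1 : continuous T1 by exact: join_weight_continuous.
have ll := join_lft_lift R cp cqa e0; rewrite -/l -/T in ll.
have lr := join_rgt_lift R cp cqa (join_inl R q a f0); rewrite -/r -/T in lr.
have l1 := lift_on_comp lr (join_lft_lift R cq ca f0); rewrite -/T1 in l1.
have r1 := lift_on_comp lr (join_rgt_lift R cq ca a0); rewrite -/T1 in r1.
(* As [r] is controlled only over {T > 0}, [T1 (r z)] is cut off by [4 T - 1]: this is 0 at
   [T = 1/4], where the branches meet, and exceeds 1 for [T > 1/2], where [t < 1] therefore forces
   [T1 (r z) < 1]. *)
pose t z := if T z - 1 / 4 <= 0 then 0
  else Num.max 0 (Num.min (4 * T z - 1) (T1 (r z))).
have tE z : T z <= 1 / 4 -> t z = 0 by move=> Tz; rewrite /t ifT//; lra.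
have ct : continuous t.
  move=> z; have cTz : continuous_at z T by exact: cT.
  apply: continuous_at_if; first by continuous_tac.
  - by move=> _; exact: continuous_at_cst.
  - move=> Tz; have cT1r : continuous_at z (fun z => T1 (r z)).
      refine (continuous_at_comp (lr.1 _ _) (cT1 _)).
      by rewrite /=; lra.
    by continuous_tac.
  - move=> Tz; rewrite max_l// ge_min; apply/orP; left; lra.
have t_gt0 z : 0 < t z -> 0 < T z /\ 0 < T1 (r z).
  rewrite /t; case: (lerP (T z - 1 / 4) 0); first by rewrite ltxx.
  by move=> ?; rewrite lt_max ltxx /= lt_min => /andP[_ ?]; split=> //; lra.
have t_lt1 z : t z < 1 -> 1 / 2 < T z -> T1 (r z) < 1.
  rewrite /t; case: (lerP (T z - 1 / 4) 0); first by move=> *; exfalso; lra.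
  move=> _; rewrite gt_max gt_min => /andP[_ /orP[|//]] ? ?; exfalso; lra.
(* The cover of the source by lifts to E, F and A is given by {T < 1},
   {T > 0, T1 r < 1} and {T > 0, T1 r > 0}; [t] separates A from E and F, and
   [2 T - 1] separates E from F inside {t < 1}. *)
have [||||w1 lw1 w1E] := @join_lift R X E F p q _ (join_map R p (join_map R q a))
    [set z | t z < 1] (fun z => 2 * T z - 1) l (join_lft R q a f0 \o r).
- apply: (@open_comp _ _ t [set s | s < 1]); last exact: open_lt.
  by move=> ? _; exact: ct.
- by move=> z _; have cTz : continuous_at z T by []; continuous_tac.
- by apply: lift_onS ll => z [/= _ Tz]; lra.
- apply: lift_onS l1 => z [/= tz Tz]; split=> /=; first by lra.
  by apply: t_lt1 => //; lra.
have [||||w lw wE] := @join_lift R X (join_space R p q) A (join_map R p q) a _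
    (join_map R p (join_map R q a)) setT t w1 (join_rgt R q a a0 \o r).
- exact: openT.
- by move=> z _; exact: ct.
- by apply: lift_onS lw1 => z [].
- by apply: lift_onS r1 => z [/= _ /t_gt0].
move: lw => /lift_on_setT[cw wJ].
exists w; split=> //.
have -> : w \o (join_inl R p (join_map R q a) \o i) =
    join_inl R (join_map R p q) a \o (join_inl R p q \o i).
  apply/funext => b /=.
  have Tb : T (join_inl R p (join_map R q a) (i b)) = - 1.
    exact: join_weight_inl.
  by rewrite wE ?tE ?Tb ?w1E ?Tb ?/l ?join_lft_inl//; lra.
apply: homotopic_refl; apply: continuous_o; last exact: join_inl_continuous.
exact: continuous_o ci (@join_inl_continuous _ _ _ _ _ _).
Qed.

Lemma dominated_joinA_rev :
  dominated (join_map R (join_map R p q) a)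
    (join_inl R (join_map R p q) a \o (join_inl R p q \o i))
    (join_map R p (join_map R q a)) (join_inl R p (join_map R q a) \o i).
Proof.
pose T := join_weight R (join_map R p q) a; pose T1 := join_weight R p q.
pose l := join_lft R (join_map R p q) a (join_inl R p q e0).
pose r := join_rgt R (join_map R p q) a a0.
have cpq : continuous (join_map R p q) by exact: join_map_continuous.
have cT : continuous T by exact: join_weight_continuous.
have cT1 : continuous T1 by exact: join_weight_continuous.
have ll := join_lft_lift R cpq ca (join_inl R p q e0); rewrite -/l -/T in ll.
have lr := join_rgt_lift R cpq ca a0; rewrite -/r -/T in lr.
have l1 := lift_on_comp ll (join_lft_lift R cp cq e0); rewrite -/T1 in l1.
have r1 := lift_on_comp ll (join_rgt_lift R cp cq f0); rewrite -/T1 in r1.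
(* As [l] is controlled only over {T < 1}, the cutoff is now [4 T - 2]: it is 1 at [T = 3/4], where
   the branches meet, and negative for [T < 1/2], where [0 < t] therefore forces [0 < T1 (l z)]. *)
pose t z := if T z - 3 / 4 <= 0 then Num.min 1 (Num.max (4 * T z - 2) (T1 (l z)))
  else 1.
have ct : continuous t.
  move=> z; have cTz : continuous_at z T by exact: cT.
  apply: continuous_at_if; first by continuous_tac.
  - move=> Tz; have cT1l : continuous_at z (fun z => T1 (l z)).
      refine (continuous_at_comp (ll.1 _ _) (cT1 _)).
      by rewrite /=; lra.
    by continuous_tac.
  - by move=> _; exact: continuous_at_cst.
  - move=> Tz; rewrite min_l// le_max; apply/orP; left; lra.
have t_lt1 z : t z < 1 -> T z < 1 /\ T1 (l z) < 1.
  rewrite /t; case: (lerP (T z - 3 / 4) 0); last by rewrite ltxx.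
  by move=> ?; rewrite gt_min ltxx /= gt_max => /andP[_ ?]; split=> //; lra.
have t_gt0 z : 0 < t z -> T z < 1 / 2 -> 0 < T1 (l z).
  rewrite /t; case: (lerP (T z - 3 / 4) 0); last by move=> *; exfalso; lra.
  move=> _; rewrite lt_min lt_max => /andP[_ /orP[|//]] ? ?; exfalso; lra.
(* Here the cover is {T < 1, T1 l < 1}, {T < 1, T1 l > 0}, {T > 0}; [t] separates
   E from F and A, and [2 T] separates F from A inside {t > 0}. *)
have [||||w1 lw1 w1E] := @join_lift R X F A q a _ (join_map R (join_map R p q) a)
    [set z | 0 < t z] (fun z => 2 * T z) (join_rgt R p q f0 \o l) r.
- apply: (@open_comp _ _ t [set s | 0 < s]); last exact: open_gt.
  by move=> ? _; exact: ct.
- by move=> z _; have cTz : continuous_at z T by []; continuous_tac.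
- apply: lift_onS r1 => z [/= tz Tz]; split=> /=; first by lra.
  by apply: t_gt0 => //; lra.
- by apply: lift_onS lr => z [/= _ Tz]; lra.
have [||||w lw wE] := @join_lift R X E (join_space R q a) p (join_map R q a) _
    (join_map R (join_map R p q) a) setT t (join_lft R p q e0 \o l) w1.
- exact: openT.
- by move=> z _; exact: ct.
- by apply: lift_onS l1 => z [/= _ /t_lt1].
- by apply: lift_onS lw1 => z [].
move: lw => /lift_on_setT[cw wJ].
exists w; split=> //.
have -> : w \o (join_inl R (join_map R p q) a \o (join_inl R p q \o i)) =
    join_inl R p (join_map R q a) \o i.
  apply/funext => b /=.
  set z := join_inl R (join_map R p q) a (join_inl R p q (i b)).
  have Tb : T z = - 1 by exact: join_weight_inl.
  have lb : l z = join_inl R p q (i b) by exact: join_lft_inl.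
  rewrite wE /= ?lb ?join_lft_inl// /t ifT ?Tb ?lb; last by lra.
  (* Both weights are -1 here, so [t] is the larger of -6 and -1. *)
  by rewrite /T1 join_weight_inl ge_min ge_max; apply/orP; right; lra.
by apply: homotopic_refl; exact: continuous_o ci (@join_inl_continuous _ _ _ _ _ _).
Qed.

End domination.

(** * Comparing the inclusions into a join; two-way domination *)

Section join_extra.
Variables (R : realType) (X : topologicalType).

(** As [g] is a map over [X], the constant path at [q f] gives a point of the homotopy pullback over
    [g f] and [f]; its segment in the cylinder connects the two inclusions. *)
Lemma join_inl_inr (E F : topologicalType) (p : E -> X) (q : F -> X) (g : F -> E) :
  continuous g -> continuous q -> p \o g = q ->
  homotopic R (join_inl R p q \o g) (join_inr R p q).
Proof.
move=> cg cq pg.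
pose b (fs : F * I01 R) : E * {compact-open, I01 R -> X} * F :=
  (g fs.1, fun=> q fs.1, fs.1).
have Pb fs : is_hpb p q (b fs).
  split=> //=; last by rewrite -pg.
  by move=> r; exact: (@continuous_at_cst _ _ r (q fs.1)).
exists (fun fs => join_mid p q (b fs) fs.2); split=> [fs|f|f].
- have c1 := @continuous_at_fst F (I01 R) fs.
  apply: join_mid_continuous; last first.
    apply: (@filterS _ _ (nbhs_filter fs) setT) => [y _|]; first exact: Pb.
    exact: (@filterT _ _ (nbhs_filter fs)).
  + exact: continuous_at_snd.
  + apply: continuous_at_pair => //; apply: continuous_at_pair.
      exact: (continuous_at_comp c1 (cg _)).
    apply: (@continuous_at_curry _ _ _ (fun x : (F * I01 R) * I01 R => q x.1.1)) => r.
    apply: (@continuous_at_comp _ _ _ (fun x : (F * I01 R) * I01 R => x.1.1) q) => //.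
    by continuous_tac.
- by rewrite (join_mid0 (Pb _)).
- by rewrite (join_mid1 (Pb _)).
Qed.

Definition equidominated (B E E' : topologicalType) (p : E -> X) (i : B -> E)
    (q : E' -> X) (j : B -> E') : Prop :=
  dominated R p i q j /\ dominated R q j p i.

Lemma equidominated_refl (B E : topologicalType) (p : E -> X) (i j : B -> E) :
  continuous p -> homotopic R i j -> equidominated p i p j.
Proof.
by move=> cp ij; split; apply: dominated_refl => //; exact: homotopic_sym.
Qed.

Lemma equidominated_trans (B E E' E'' : topologicalType) (p : E -> X)
    (i : B -> E) (q : E' -> X) (j : B -> E') (r : E'' -> X) (k : B -> E'') :
  equidominated p i q j -> equidominated q j r k -> equidominated p i r k.
Proof.
by move=> [pq qp] [qr rq]; split; [exact: dominated_trans pq qr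
                                  |exact: dominated_trans rq qp].
Qed.

(** Serves the case of empty [A], in which the joins have no default points. *)
Lemma dominated_empty (B E E' : topologicalType) (p : E -> X)
    (i : B -> E) (q : E' -> X) (j : B -> E') :
  (E -> False) -> dominated R p i q j.
Proof.
move=> nE; exists (fun e => False_rect E' (nE e)); split=> [e||].
- by case: (nE e).
- by exists (fun er => p er.1); split=> [[e r]|e|e]; case: (nE e).
- by exists (fun br => j br.1); split=> [[b r]|b|b]; case: (nE (i b)).
Qed.

End join_extra.

(** * Ganea constructions *)

Section ganea_join.
Variables (R : realType) (A X : topologicalType) (iota : A -> X).
Hypothesis ci : continuous iota.
Local Notation G := (ganea_space R iota).
Local Notation g := (ganea_map R iota).

Let cg i : continuous (g i). Proof. exact: ganea_map_continuous. Qed.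

Lemma ganea_empty : (A -> False) -> forall i, G i -> False.
Proof.
move=> nA; elim=> [//|i IH].
elim/(@join_ind R X (G i) A (g i) iota) => -[[[]|] y].
- exact: IH y.
- exact: nA y.
- exact: nA (hpb_snd R (g i) iota y.1).
Qed.

Lemma ganea_alpha_continuous i : continuous (ganea_alpha R iota i).
Proof.
case: i => [|i]; first by move=> x; exact: cvg_id.
exact: (@join_inr_continuous R X (G i) A (g i) iota).
Qed.

Lemma ganea_map_alpha i : g i \o ganea_alpha R iota i = iota.
Proof.
case: i => [//|i]; apply/funext => x.
exact: (@join_map_inr R X (G i) A (g i) iota).
Qed.

Lemma ganea_alphaS i :
  homotopic R (ganea_gamma R iota i \o ganea_alpha R iota i)
    (ganea_alpha R iota i.+1).
Proof.
apply: (@join_inl_inr R X (G i) A (g i) iota) => //.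
- exact: ganea_alpha_continuous.
- exact: ganea_map_alpha.
Qed.

Lemma ganea_gammas_continuous k m : continuous (ganea_gammas R iota k m).
Proof.
elim: m => [|m IH]; first by move=> x; exact: cvg_id.
exact: continuous_o IH (@join_inl_continuous R X (G (m + k)) A (g (m + k)) iota).
Qed.

(* The two targets G_(j + (m + k)) and G_(j + m + k) are only propositionally
   equal, hence the equality of dependent pairs. *)
Lemma ganea_gammas_comp k m j :
  existT (fun N => G k -> G N) (j + (m + k))%N
    (ganea_gammas R iota (m + k) j \o ganea_gammas R iota k m) =
  existT (fun N => G k -> G N) (j + m + k)%N (ganea_gammas R iota k (j + m)).
Proof.
elim: j => [//|j IH].
pose next (s : {N & G k -> G N}) : {N & G k -> G N} :=
  existT _ (projT1 s).+1 (ganea_gamma R iota (projT1 s) \o projT2 s).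
exact: (congr1 next IH).
Qed.

(** Makes the condition in [relcat_order] stable under raising the index. *)
Lemma ganea_gammas_dominated k m :
  dominated R (g (m + k)) (ganea_gammas R iota k m)
              (g (m.+1 + k)) (ganea_gammas R iota k m.+1).
Proof.
exists (ganea_gamma R iota (m + k)); split.
- exact: (@join_inl_continuous R X (G (m + k)) A (g (m + k)) iota).
- have -> : g (m.+1 + k) \o ganea_gamma R iota (m + k) = g (m + k).
    by apply/funext => x; exact: (@join_map_inl R X (G (m + k)) A (g (m + k)) iota).
  by apply: homotopic_refl; exact: cg.
- by apply: homotopic_refl; exact: ganea_gammas_continuous.
Qed.

Variable a0 : A.
Let pt i : G i := ganea_alpha R iota i a0.

(** Induction on [k]: [g k.+1] is by definition the join of [g k] and [iota]. Associativity moves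
    [iota] outside, and the induction hypothesis is then joined with [iota]. *)
Lemma join_ganea (B : topologicalType) m k (i : B -> G m) : continuous i ->
  equidominated R (join_map R (g m) (g k)) (join_inl R (g m) (g k) \o i)
    (g (k.+1 + m)) (ganea_gammas R iota m k.+1 \o i).
Proof.
move=> cti; elim: k => [|k [IH IH']].
  apply: equidominated_refl; first exact: join_map_continuous.
  apply: homotopic_refl.
  exact: continuous_o cti (@join_inl_continuous R X _ _ (g m) iota).
have cj : continuous (join_map R (g m) (g k)) by exact: join_map_continuous.
split.
- refine (dominated_trans _ (dominated_joinl cj ci _ a0 IH)).
    exact: (dominated_joinA R (@cg m) (@cg k) (pt m) (pt k) cti a0 ci).
  exact: (join_inl R (g m) (g k) (pt m)).
- apply: dominated_trans (dominated_joinl (@cg (k.+1 + m)) ci (pt _) a0 IH') _.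
  exact: (dominated_joinA_rev R (@cg m) (@cg k) (pt m) (pt k) cti a0 ci).
Qed.

End ganea_join.

(** * The Ganea construction of a Ganea map *)

Section ganea_ganea.
Variables (R : realType) (A X : topologicalType) (iota : A -> X) (k : nat).
Hypothesis ci : continuous iota.
Local Notation g := (ganea_map R iota).

(** Stage [n] joins [n.+1] copies of [g k], each a join of [k.+1] copies of [iota]; a join of
    [n.+1 * k.+1] copies has index one less, [n * k.+1 + k]. *)
Lemma ganea_ganea n :
  equidominated R (ganea_map R (g k) n) (ganea_alpha R (g k) n)
    (g (n * k.+1 + k)) (ganea_gammas R iota k (n * k.+1)).
Proof.
have cg i : continuous (g i) by exact: ganea_map_continuous.
have cgg i : continuous (ganea_map R (g k) i) by exact: ganea_map_continuous.
have [[a0]|nA] := pselect (inhabited A); last first.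
  have nG i : ganea_space R iota i -> False.
    by apply: ganea_empty => a; apply: nA; exists.
  by split; apply: dominated_empty; [exact: ganea_empty (nG k) n|exact: nG].
pose pt i := ganea_alpha R iota i a0.
elim: n => [|n [IH IH']].
  by apply: equidominated_refl => //; apply: homotopic_refl => x; exact: cvg_id.
pose N := (n * k.+1 + k)%N.
(* [dominated_joinl] only tracks maps through the left inclusion, so the right inclusion
   [ganea_alpha] at stage [n.+1] is first deformed into a map through stage [n]. *)
apply: (@equidominated_trans _ _ _ _ _ _ _ _ _
  (ganea_gamma R (g k) n \o ganea_alpha R (g k) n)).
  by apply: equidominated_refl => //; apply: homotopic_sym; exact: ganea_alphaS.
apply: (@equidominated_trans _ _ _ _ _ _ _ _ (join_map R (g N) (g k))
    (join_inl R (g N) (g k) \o ganea_gammas R iota k (n * k.+1))).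
  split.
  - exact: (dominated_joinl (cgg n) (cg k) (ganea_alpha R (g k) n (pt k)) (pt k) IH).
  - exact: (dominated_joinl (cg N) (cg k) (pt N) (pt k) IH').
(* Stated for a pair of index and map, so that [ganea_gammas_comp] rewrites both at once. *)
pose P (s : {M & ganea_space R iota k -> ganea_space R iota M}) :=
  equidominated R (join_map R (g N) (g k))
    (join_inl R (g N) (g k) \o ganea_gammas R iota k (n * k.+1))
    (g (projT1 s)) (projT2 s).
have : P (existT _ _
    (ganea_gammas R iota N k.+1 \o ganea_gammas R iota k (n * k.+1))).
  by apply: join_ganea => //; exact: ganea_gammas_continuous.
by rewrite ganea_gammas_comp.
Qed.

End ganea_ganea.

(** [Q] holds exactly from its least element [q] on, and [q <= n * k.+1 + k] amounts to
    [q %/ k.+1 <= n]. *)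
Lemma least_divn (P Q : nat -> Prop) (k : nat) :
  (forall n, P n <-> Q (n * k.+1 + k)%N) ->
  (forall n, Q n -> Q n.+1) ->
  least P = omap (fun n => (n %/ k.+1)%N) (least Q).
Proof.
move=> PQ Qs; have Qle m n : (m <= n)%N -> Q m -> Q n.
  by move=> /subnK <-; elim: (n - m)%N => // d IH /IH /Qs.
rewrite /least; case: pselect => [exP|nP]; case: pselect => [exQ|nQ] //=.
- congr Some; case: ex_minnP => p /asboolP Pp pmin.
  case: ex_minnP => q /asboolP Qq qmin.
  apply/eqP; rewrite eqn_leq; apply/andP; split.
    apply: pmin; apply/asboolP/PQ; apply: Qle Qq.
    by rewrite {1}(divn_eq q k.+1) leq_add2l -ltnS ltn_mod.
  (* Minimality gives [q <= p * k.+1 + k]; dividing, [k] contributes nothing as [k < k.+1]. *)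
  have := qmin _ (asboolT ((PQ p).1 Pp)) => /(leq_div2r k.+1).
  by rewrite divnMDl// (divn_small (ltnSn k)) addn0.
- exfalso; case: exP => p /asboolP/PQ Qp; apply: nQ.
  by eexists; apply/asboolP; exact: Qp.
- exfalso; case: exQ => q /asboolP Qq; apply: nP; exists (q %/ k.+1)%N.
  apply/asboolP/PQ; apply: Qle Qq.
  by rewrite {1}(divn_eq q k.+1) leq_add2l -ltnS ltn_mod.
Qed.

Theorem proposition7 (R : realType) (A X : topologicalType) (iota : A -> X)
    (iota_cont : continuous iota) (k : nat) :
  relcat R (ganea_map R iota k) =
  omap (fun n : nat => (n %/ k.+1)%N) (relcat_order R k iota).
Proof.
(* The conditions in [relcat] and [relcat_order] are both dominations of the identity of [X], so the
   two halves of [ganea_ganea] carry one to the other. *)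
pose D m := dominated R (@id X) (ganea_map R iota k)
  (ganea_map R iota (m + k)) (ganea_gammas R iota k m).
rewrite /relcat /relcat_order; apply: least_divn => [n|n [m -> Dm]].
  have [GN NG] := ganea_ganea R k iota_cont n.
  split=> [Pn|[m /addIn <-] Dm].
    by exists (n * k.+1)%N => //; exact: (dominated_trans Pn GN).
  exact: (dominated_trans Dm NG).
exists m.+1 => //.
exact: (dominated_trans Dm (ganea_gammas_dominated R iota_cont k m)).
Qed.
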